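(* Let $N\ge2$, let $J_1,J_2$ be the two Poisson tensors of the Toda lattice in natural coordinates $(q_1,\dots,q_N,p_1,\dots,p_N)$ on $\mathbb{R}^{2N}$, let $\mathcal{R}=J_2J_1^{-1}$ be the recursion operator, let $J_j=\mathcal{R}^{j-1}J_1$, and let $Y_j=D(J_j)$ be the modular vector field of $J_j$. Put $f=\ln(\sqrt{\det\mathcal{R}})$. Then for every integer $j\ge1$, on the open set where $\det\mathcal{R}>0$, $Y_j$ is the Hamiltonian vector field $$Y_j=(j-1)\,\mathcal{X}_f^{J_j}.$$
   Context: Coordinates: $(x_1,\dots,x_{2N})=(q_1,\dots,q_N,p_1,\dots,p_N)$. A Poisson tensor $J$ is identified with its matrix $J_{ik}=\{x_i,x_k\}_J$. The Hamiltonian vector field of a function $h$ is $\mathcal{X}_h^{J}=J\nabla h$, i.e. its $x_i$-component is $\{x_i,h\}_J$. The modular vector field (with respect to the standard volume) of $J$ is $$D(J)=\sum_{k}\Big(\sum_{i}\frac{\partial J_{ki}}{\partial x_i}\Big)\frac{\partial}{\partial x_k}.$$ The tensors are $J_1=4\hat J_1$, $J_2=2\hat J_2$ with $$\hat J_1=\begin{pmatrix}0&I_N\\-I_N&0\end{pmatrix},\qquad \hat J_2=\begin{pmatrix}A_N&B_N\\-B_N&C_N\end{pmatrix},$$ where $I_N$ is the $N\times N$ identity matrix, $A_N$ is the skew-symmetric matrix with entries $1$ for $i<j$ and $-1$ for $i>j$, $B_N=\operatorname{diag}(-p_1,\dots,-p_N)$, and $C_N$ is the skew-symmetric matrix whose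 only nonzero entries are $c_{i,i+1}=-c_{i+1,i}=e^{q_i-q_{i+1}}$, $1\le i\le N-1$. *)

(* Defs.v *)
From HB Require Import structures.
From mathcomp Require Import all_boot all_order all_algebra.
From mathcomp Require Import all_classical all_reals all_analysis.

Set Implicit Arguments.
Unset Strict Implicit.
Unset Printing Implicit Defensive.

Import Order.TTheory GRing.Theory Num.Theory.
Import numFieldNormedType.Exports.

Local Open Scope ring_scope.

(* A bivector field on R^n is represented by the matrix-valued function
   x |-> J x with (J x) i k = {x_i, x_k}_J; a vector field is represented by
   its column of components. *)
Section VectorFields.
Variables (R : realType) (n : nat).

Definition pderiv (i : 'I_n) (g : 'cV[R]_n -> R) (x : 'cV[R]_n) : R :=
  'D_(delta_mx i 0) g x.

Definition grad (g : 'cV[R]_n -> R) (x : 'cV[R]_n) : 'cV[R]_n :=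
  \col_i pderiv i g x.

Definition hamiltonian_field (J : 'cV[R]_n -> 'M[R]_n) (h : 'cV[R]_n -> R)
    (x : 'cV[R]_n) : 'cV[R]_n :=
  J x *m grad h x.

(* Modular vector field with respect to the standard volume. *)
Definition modular_field (J : 'cV[R]_n -> 'M[R]_n) (x : 'cV[R]_n) :
    'cV[R]_n :=
  \col_k \sum_(i < n) pderiv i (fun y => J y k i) x.

End VectorFields.

Section Toda.
Variables (R : realType) (N : nat).

(* The phase space is 'cV[R]_(N + N), with x = (q_1..q_N, p_1..p_N). *)
Definition coord_q (x : 'cV[R]_(N + N)) (i : 'I_N) : R := x (lshift N i) 0.
Definition coord_p (x : 'cV[R]_(N + N)) (i : 'I_N) : R := x (rshift N i) 0.

Definition toda_A : 'M[R]_N :=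
  \matrix_(i, j) if (i < j)%N then 1 else if (j < i)%N then -1 else 0.

Definition toda_B (x : 'cV[R]_(N + N)) : 'M[R]_N :=
  diag_mx (\row_i - coord_p x i).

Definition toda_C (x : 'cV[R]_(N + N)) : 'M[R]_N :=
  \matrix_(i, j)
    if j == i.+1 :> nat then expR (coord_q x i - coord_q x j)
    else if i == j.+1 :> nat then - expR (coord_q x j - coord_q x i)
    else 0.

Definition toda_J1hat (x : 'cV[R]_(N + N)) : 'M[R]_(N + N) :=
  block_mx 0 1%:M (- 1%:M) 0.

Definition toda_J2hat (x : 'cV[R]_(N + N)) : 'M[R]_(N + N) :=
  block_mx toda_A (toda_B x) (- toda_B x) (toda_C x).

Definition toda_J1 (x : 'cV[R]_(N + N)) : 'M[R]_(N + N) :=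
  4%:R *: toda_J1hat x.

Definition toda_J2 (x : 'cV[R]_(N + N)) : 'M[R]_(N + N) :=
  2%:R *: toda_J2hat x.

Definition recursion_operator (x : 'cV[R]_(N + N)) : 'M[R]_(N + N) :=
  toda_J2 x *m invmx (toda_J1 x).

(* The hierarchy is indexed from j = 1; the value at j = 0 is junk. *)
Definition toda_J (j : nat) (x : 'cV[R]_(N + N)) : 'M[R]_(N + N) :=
  recursion_operator x ^+ (j - 1)%N *m toda_J1 x.

Definition toda_Y (j : nat) : 'cV[R]_(N + N) -> 'cV[R]_(N + N) :=
  modular_field (toda_J j).

Definition toda_f (x : 'cV[R]_(N + N)) : R :=
  ln (Num.sqrt (\det (recursion_operator x))).

End Toda.

(* Main.v *)
Require Import Defs.
From mathcomp Require Import all_boot all_order all_algebra all_fingroup.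
From mathcomp Require Import all_classical all_reals all_analysis.
From mathcomp Require Import zify ring.

(** Write K = J1^-1, R = J2 K for the recursion operator and, at a fixed point,
    dJ r for the partial derivative of J2 along x_r; J1 is constant, so that
    R has partial derivatives dJ r K.  The argument uses only that J1 and J2 are
    skew, that J1 and (where det R > 0) J2 are invertible, and two cyclic
    identities: the Jacobi identity of J2, and its compatibility with J1.

    For a matrix M let w(M) be the vector with components
    sum_(r, l) dJ r s l * M r l, and for a matrix Z let u(Z) be the covector with
    components tr (dJ r Z).  Contracting a cyclic identity for P with a skew Z
    turns two of its three terms into copies of w(P Z), which gives
    P u(Z) = 2 w(P Z) (lemma cyclic_contraction).  This is applied to P = J1 and
    to P = J2 with the skew matrices Z = K R^b.  The two resulting equations
    share u(K R^b), and eliminating it yields w(R^(b+1)) = R w(R^b), hence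
    w(R^b) = R^b w(1).

    By the product rule, the divergence of R^m J1 is the sum over a + b = m - 1
    of R^a w(R^b); every term equals R^(m-1) w(1), so the divergence is
    m R^(m-1) w(1) (lemma divergence_hierarchy).  Finally, P = J2 with
    Z = J2^-1 gives 2 w(1) = J2 u(J2^-1), while Jacobi's formula for the
    derivative of a determinant gives grad f = u(J2^-1) / 2 (lemma
    grad_toda_f).  Hence w(1) = R J1 grad f and the divergence is
    m R^m J1 grad f, with m = j - 1.

    For the Toda tensors the cyclic identities are checked block by block
    (lemma toda_cyclic): the coefficients c_(i,j) depend on q only through
    q_i - q_j, the block B is diagonal, and the interplay of A with C is a
    comparison of indices. *)

Set Implicit Arguments.
Unset Strict Implicit.
Unset Printing Implicit Defensive.
Import Order.TTheory GRing.Theory Num.Theory.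
Import numFieldNormedType.Exports.
Local Open Scope ring_scope.

(** * Contraction of the cyclic identities *)

Section CyclicContraction.
Variables (F : numFieldType) (n : nat).
Implicit Types (P Z M : 'M[F]_n) (dJ : 'I_n -> 'M[F]_n).

(** When dJ r is the partial derivative along x_r of a matrix J, this is
    the bracket of x_s with J_lt computed in the tensor P; the cyclic sum below
    then vanishes for P = J by the Jacobi identity, and for a constant P exactly
    when P and J are compatible. *)
Definition bracket P dJ (s l t : 'I_n) : F := \sum_r P s r * dJ r l t.
Definition cyclic_sum P dJ s l t : F :=
  bracket P dJ s l t + bracket P dJ l t s + bracket P dJ t s l.

(** For Z = K M this is the covector with components tr (M dR), where dR = dJ K
    is the derivative of R = J K. *)
Definition trace_form dJ Z : 'cV[F]_n := \col_r \tr (dJ r *m Z).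

(** For M = 1 this is the modular vector field of J; for M = R^b it is what one
    factor R of a power of R contributes to the divergence, the b factors to its
    right having been moved by transposition to the index of differentiation. *)
Definition contracted_div dJ M : 'cV[F]_n :=
  \col_s \sum_r \sum_l dJ r s l * M r l.

(** Contract the identity with Z_tl over l and t.  The term with free index s
    outside dJ is P applied to the traces.  In the other two, s is an index of
    dJ; skewness of Z and of dJ makes them equal, and skewness of P turns each
    into minus the vector attached to P Z. *)
Lemma cyclic_contraction P dJ Z :
  P^T = - P -> Z^T = - Z -> (forall r, (dJ r)^T = - dJ r) ->
  (forall s l t, cyclic_sum P dJ s l t = 0) ->
  P *m trace_form dJ Z = 2%:R *: contracted_div dJ (P *m Z).
Proof.
move=> /matrixP skP /matrixP skZ skJ cyc.
have eP a b : P a b = - P b a by have := skP b a; rewrite !mxE.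
have eZ a b : Z a b = - Z b a by have := skZ b a; rewrite !mxE.
have eJ r a b : dJ r a b = - dJ r b a.
  by have /matrixP/(_ b a) := skJ r; rewrite !mxE.
apply/matrixP => s o; rewrite {o}(ord1 o) !mxE.
have -> : \sum_j P s j * trace_form dJ Z j 0 =
    \sum_l \sum_t bracket P dJ s l t * Z t l.
  under eq_bigr => j _.
    rewrite mxE /mxtrace mulr_sumr.
    under eq_bigr => l _ do rewrite mxE mulr_sumr.
    over.
  rewrite exchange_big; apply: eq_bigr => l _.
  rewrite exchange_big; apply: eq_bigr => t _.
  by rewrite /bracket mulr_suml; apply: eq_bigr => r _; rewrite mulrA.
(* T is the contraction of either term having s as an index of dJ. *)
pose T := \sum_l \sum_t bracket P dJ t s l * Z t l.
have -> : \sum_r \sum_l dJ r s l * (P *m Z) r l = - T.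
  rewrite /T exchange_big -sumrN; apply: eq_bigr => l _.
  under eq_bigr => r _ do rewrite mxE mulr_sumr.
  rewrite exchange_big -sumrN; apply: eq_bigr => t _.
  rewrite /bracket mulr_suml -sumrN; apply: eq_bigr => r _.
  by rewrite (eP r t) mulNr mulrN mulrA [dJ r s l * _]mulrC.
have E : \sum_l \sum_t bracket P dJ l t s * Z t l = T.
  rewrite /T exchange_big; apply: eq_bigr => l _; apply: eq_bigr => t _.
  rewrite (eZ t l) mulrN -mulNr; congr (_ * _).
  rewrite /bracket -sumrN; apply: eq_bigr => r _.
  by rewrite (eJ r l s) mulrN.
suff : \sum_l \sum_t bracket P dJ s l t * Z t l + T + T = 0.
  by rewrite mulrN mulr_natl mulr2n -addrA => /eqP; rewrite addr_eq0 => /eqP.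
rewrite -{1}E /T -!big_split big1 // => l _.
rewrite -!big_split big1 //= => t _.
by rewrite -!mulrDl -[X in X * _]/(cyclic_sum P dJ s l t) cyc mul0r.
Qed.

Section CompatiblePair.
Variables (J1 J2 : 'M[F]_n) (dJ : 'I_n -> 'M[F]_n).
Hypotheses (skJ1 : J1^T = - J1) (skJ2 : J2^T = - J2).
Hypothesis skdJ : forall r, (dJ r)^T = - dJ r.
Hypotheses (uJ1 : J1 \in unitmx) (uJ2 : J2 \in unitmx).
Hypothesis cyc1 : forall s l t, cyclic_sum J1 dJ s l t = 0.
Hypothesis cyc2 : forall s l t, cyclic_sum J2 dJ s l t = 0.
Local Notation K := (invmx J1).
Local Notation R := (J2 *m K).

Lemma trmx_inv_skew J : J^T = - J -> (invmx J)^T = - invmx J :> 'M[F]_n.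
Proof.
move=> sk; rewrite trmx_inv sk -scaleN1r.
have [uJ|nJ] := boolP (J \in unitmx).
  by rewrite invmxZ ?unitmxZ ?unitrN1 // invrN1 scaleN1r.
have nJ' : -1 *: J \notin unitmx by rewrite unitmxZ ?unitrN1.
by rewrite /invmx (negbTE nJ) (negbTE nJ') scaleN1r.
Qed.

(** K R^b = K J2 K ... J2 K is a product of 2 b + 1 skew matrices that reads
    the same backwards. *)
Lemma skew_inv_recursion b : (K *m R ^+ b)^T = - (K *m R ^+ b).
Proof.
elim: b => [|b IH]; first by rewrite expr0 mulmx1 trmx_inv_skew.
rewrite exprS -[R * _]/(R *m _) !mulmxA -[_ *m J2 *m K *m _]mulmxA.
rewrite trmx_mul IH trmx_mul trmx_inv_skew // skJ2.
rewrite (mulmxN (- J2)) (mulNmx J2) opprK mulNmx -!mulmxA; congr (- (K *m _)).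
rewrite [RHS]mulmxA; exact: (commr_sym (commrX b (commr_refl R))).
Qed.

(** The contraction with P = J1 and with P = J2 of the same skew matrix K R^b
    expresses the vectors of R^b and of R^(b+1) through one and the same
    covector; eliminating it is the whole induction step. *)
Lemma contracted_div_recursion b :
  contracted_div dJ (R ^+ b) = R ^+ b *m contracted_div dJ 1%:M.
Proof.
have two0 : 2%:R != 0 :> F by rewrite pnatr_eq0.
elim: b => [|b IH]; first by rewrite expr0 mul1mx.
apply: (scalerI two0); rewrite exprS -[R * _]/(R *m _).
rewrite -[R *m _ *m contracted_div _ _]mulmxA -IH scalemxAr.
have e1 : J1 *m (K *m R ^+ b) = R ^+ b by rewrite mulKVmx.
have e2 : J2 *m (K *m R ^+ b) = R *m R ^+ b by rewrite mulmxA.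
rewrite -{1}e2 -{2}e1.
rewrite -!cyclic_contraction //; try exact: skew_inv_recursion.
by rewrite !mulmxA mulmxKV.
Qed.

Lemma contracted_div1 :
  2%:R *: contracted_div dJ 1%:M = J2 *m trace_form dJ (invmx J2).
Proof. by rewrite cyclic_contraction ?trmx_inv_skew // mulmxV. Qed.

(** The product rule for A ^+ m, with dA in place of the derivative of A; the
    recursion keeps the order of the factors, as A and dA need not commute. *)
Fixpoint deriv_expmx (A dA : 'M[F]_n) m : 'M[F]_n :=
  if m is m'.+1 then dA *m A ^+ m' + A *m deriv_expmx A dA m' else 0.

(** Each of the m terms of the product rule contributes R^a applied to the
    vector of R^b with a + b = m - 1, that is R^(m-1) applied to that of 1;
    the induction on m peels off the leftmost factor R. *)
Lemma divergence_hierarchy m :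
  \col_k \sum_r (deriv_expmx R (dJ r *m K) m *m J1) k r =
  m%:R *: (R ^+ m *m J1 *m ((2%:R)^-1 *: trace_form dJ (invmx J2))).
Proof.
have two0 : 2%:R != 0 :> F by rewrite pnatr_eq0.
set g := _ *: trace_form _ _.
have gE : R *m J1 *m g = contracted_div dJ 1%:M.
  by rewrite mulmxKV // /g -scalemxAr -contracted_div1 scalerA mulVf // scale1r.
elim: m => [|m IH].
  rewrite scale0r; apply/matrixP => k o; rewrite !mxE big1 // => r _.
  by rewrite mul0mx mxE.
have -> : (\col_k \sum_r (deriv_expmx R (dJ r *m K) m.+1 *m J1) k r) =
  contracted_div dJ (R ^+ m) +
  R *m (\col_k \sum_r (deriv_expmx R (dJ r *m K) m *m J1) k r).
  apply/matrixP => k o; rewrite {o}(ord1 o) !mxE.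
  under eq_bigr => r _ do rewrite /= mulmxDl mxE.
  rewrite big_split /=; congr (_ + _).
    apply: eq_bigr => r _; rewrite -!mulmxA mxE; apply: eq_bigr => l _.
    congr (_ * _).
    (* R^m has transpose K R^m J1, because K R^m and K are skew *)
    have -> : K *m (R ^+ m *m J1) = (R ^+ m)^T.
      rewrite mulmxA -[K *m _]opprK -skew_inv_recursion trmx_mul.
      by rewrite trmx_inv_skew // mulmxN opprK mulmxKV.
    by rewrite mxE.
  under [RHS]eq_bigr => l _ do rewrite mxE mulr_sumr.
  rewrite exchange_big /=; apply: eq_bigr => r _.
  by rewrite -mulmxA mxE.
rewrite IH contracted_div_recursion -gE -(scalemxAr m%:R R).
have eR : R ^+ m *m R = R ^+ m.+1 by rewrite exprSr.
have eR' : R *m R ^+ m = R ^+ m.+1 by rewrite exprS.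
rewrite -[R *m J1 *m g]mulmxA (mulmxA (R ^+ m) R) eR.
rewrite -[R ^+ m *m J1 *m g]mulmxA (mulmxA R) eR' -[R ^+ m.+1 *m J1 *m g]mulmxA.
by rewrite -[X in X + _]scale1r -scalerDl mulrS.
Qed.

End CompatiblePair.
End CyclicContraction.

(** * Directional derivatives of matrix-valued functions *)

Section DirectionalDerivative.
Variables (R : realType) (V : normedModType R).
Implicit Types (x v : V).

Lemma is_derive_ext x v (f g : V -> R) d : f =1 g ->
  is_derive x v f d -> is_derive x v g d.
Proof. by move=> /funext <-. Qed.

(** Directional derivatives are ordinary derivatives along a line, which
    gives access to the one-variable chain rule. *)
Lemma is_derive_line x v (g : V -> R) d :
  is_derive x v g d <-> is_derive (0 : R) 1 (fun h => g (h *: v + x)) d.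
Proof.
have E : (fun h : R => h^-1 *: ((g \o shift x) (h *: v) - g x)) =
  (fun h : R => h^-1 *: (((fun k => g (k *: v + x)) \o shift 0) (h *: (1 : R)) -
      (fun k => g (k *: v + x)) 0)).
  by apply/funext => h /=; rewrite addr0 scale0r add0r [h *: 1]mulr1.
by split=> -[]; rewrite /derivable /derive => Hd Hv; split;
  rewrite /derivable /derive; move: Hd Hv; rewrite E.
Qed.

Lemma is_derive_comp x v (f : R -> R) (g : V -> R) a b :
  is_derive (g x) 1 f a -> is_derive x v g b -> is_derive x v (f \o g) (a * b).
Proof.
move=> df /is_derive_line dg; apply/is_derive_line.
apply: (@is_derive1_comp _ f (fun h => g (h *: v + x))) => //=.
by rewrite scale0r add0r.
Qed.

Lemma is_derive_bigsum (I : Type) (s : seq I) x v (h : I -> V -> R) (dh : I -> R) :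
  (forall i, is_derive x v (h i) (dh i)) ->
  is_derive x v (fun y => \sum_(i <- s) h i y) (\sum_(i <- s) dh i).
Proof.
move=> H; elim: s => [|i s IH].
  rewrite big_nil; apply: is_derive_ext (is_derive_cst _ _ _) => y.
  by rewrite big_nil.
rewrite big_cons; apply: is_derive_ext (is_deriveD (H i) IH) => y.
by rewrite big_cons.
Qed.

Lemma is_derive_bigprod (I : eqType) (s : seq I) x v (h : I -> V -> R)
    (dh : I -> R) : uniq s ->
  (forall i, is_derive x v (h i) (dh i)) ->
  is_derive x v (fun y => \prod_(i <- s) h i y)
    (\sum_(k <- s) \prod_(i <- s) if i == k then dh i else h i x).
Proof.
move=> + H; elim: s => [_|i s IH] /=.
  rewrite big_nil; apply: is_derive_ext (is_derive_cst _ _ _) => y.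
  by rewrite big_nil.
move=> /andP[is_ us].
apply: (@is_derive_ext _ _ (h i * (fun y => \prod_(i <- s) h i y))).
  by move=> y; rewrite big_cons.
apply: is_derive_eq (is_deriveM (H i) (IH us)) _.
rewrite !big_cons eqxx [in RHS]addrC; congr (_ + _); last first.
  rewrite [LHS]mulrC; congr (_ * _); apply: eq_big_seq => k ks.
  by case: eqP => // e; rewrite -e ks in is_.
rewrite [LHS]mulr_sumr; apply: eq_big_seq => k ks; rewrite big_cons.
by case: eqP => // e; rewrite e ks in is_.
Qed.

Lemma is_derive_mxP m n x v (F : V -> 'M[R]_(m, n)) (dF : 'M[R]_(m, n)) :
  is_derive x v F dF <->
  forall i j, is_derive x v (fun y => F y i j) (dF i j).
Proof.
split=> [[Fd <-] i j|H].
  by split; [exact: (derivable_mxP _ _ _).1 | rewrite derive_mx // mxE].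
have Fd : derivable F x v by apply/derivable_mxP => i j; have [] := H i j.
split=> //; rewrite derive_mx //; apply/matrixP => i j; rewrite mxE.
by have [] := H i j.
Qed.

Lemma is_derive_mulmx m n p x v (F : V -> 'M[R]_(m, n)) (G : V -> 'M[R]_(n, p))
    (dF : 'M[R]_(m, n)) (dG : 'M[R]_(n, p)) :
  is_derive x v F dF -> is_derive x v G dG ->
  is_derive x v (fun y => F y *m G y) (dF *m G x + F x *m dG).
Proof.
move=> /is_derive_mxP HF /is_derive_mxP HG; apply/is_derive_mxP => i j.
apply: (@is_derive_ext _ _ (fun y => \sum_k F y i k * G y k j)).
  by move=> y; rewrite mxE.
rewrite !mxE -big_split /=; apply: is_derive_bigsum => k.
apply: is_derive_eq (is_deriveM (HF i k) (HG k j)) _.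
by rewrite addrC; congr (_ + _); exact: mulrC.
Qed.

Lemma is_derive_mulmxr m n p x v (F : V -> 'M[R]_(m, n)) (dF : 'M[R]_(m, n))
    (A : 'M[R]_(n, p)) :
  is_derive x v F dF -> is_derive x v (fun y => F y *m A) (dF *m A).
Proof.
move=> HF; apply: is_derive_eq (is_derive_mulmx HF (is_derive_cst A x v)) _.
by rewrite mulmx0 addr0.
Qed.

Lemma is_derive_expmx n x v (F : V -> 'M[R]_n) (dF : 'M[R]_n) m :
  is_derive x v F dF ->
  is_derive x v (fun y => F y ^+ m) (deriv_expmx (F x) dF m).
Proof.
move=> HF; elim: m => [|m IH]; first exact: is_derive_cst.
have -> : (fun y => F y ^+ m.+1) = (fun y => F y *m F y ^+ m).
  by apply/funext => y; rewrite exprS.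
exact: is_derive_mulmx.
Qed.

(** Jacobi's formula.  In the Leibniz expansion, differentiating the k-th
    factor of every product gives the determinant with row k replaced by its
    derivative, and Laplace expansion along that row brings in cofactors. *)
Lemma is_derive_det n x v (F : V -> 'M[R]_n) (dF : 'M[R]_n) :
  is_derive x v F dF ->
  is_derive x v (fun y => \det (F y)) (\tr (dF *m \adj (F x))).
Proof.
move=> /is_derive_mxP HF.
pose Fk k : 'M[R]_n := \matrix_(i, j) if i == k then dF i j else F x i j.
apply: is_derive_eq.
  apply: is_derive_bigsum => s.
  apply: (is_deriveZ (f := fun y => \prod_i F y i (s i)) ((-1) ^+ s)).
  exact: (is_derive_bigprod (index_enum_uniq _) (fun i => HF i (s i))).
transitivity (\sum_k \det (Fk k)).
  rewrite [RHS]exchange_big /=; apply: eq_bigr => s _.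
  rewrite -[LHS]/(_ * _) mulr_sumr; apply: eq_bigr => k _; congr (_ * _).
  by apply: eq_bigr => i _; rewrite mxE.
apply: eq_bigr => k _; rewrite (expand_det_row _ k) mxE.
apply: eq_bigr => j _; rewrite !mxE eqxx; congr (_ * _).
rewrite /cofactor; congr (_ * \det _); apply/matrixP => a b; rewrite !mxE.
by rewrite eq_sym (negbTE (neq_lift _ _)).
Qed.

End DirectionalDerivative.

Lemma is_derive_entry (R : realType) m n (x v : 'M[R]_(m, n)) i j :
  is_derive x v (fun y : 'M[R]_(m, n) => y i j) (v i j).
Proof. by move: i j; apply/is_derive_mxP; exact: is_derive_id. Qed.

(** * The Toda tensors *)

Section TodaTensors.
Variables (R : realType) (N : nat).
Implicit Types (x : 'cV[R]_(N + N)) (P : 'M[R]_(N + N)).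
Local Notation q := (lshift N).
Local Notation p := (@rshift N N).

(** The absolute value of the (j, k) entry of the block C: unlike C itself it is
    symmetric, and the derivative of C along q_m is this weight times
    (m == j) - (m == k), whatever the sign of the entry. *)
Definition toda_weight x (j k : 'I_N) : R :=
  if k == j.+1 :> nat then expR (coord_q x j - coord_q x k)
  else if j == k.+1 :> nat then expR (coord_q x k - coord_q x j) else 0.

Lemma toda_weightC x j k : toda_weight x j k = toda_weight x k j.
Proof. by rewrite /toda_weight; do ![case: eqP => //] => *; lia. Qed.

Definition toda_dC x (m : 'I_N) : 'M[R]_N :=
  \matrix_(j, k) (toda_weight x j k * ((m == j)%:R - (m == k)%:R)).

(** Of the blocks of J2 only C depends on q, and only B on p. *)
Definition toda_dJ2 x (r : 'I_(N + N)) : 'M[R]_(N + N) :=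
  2%:R *: match fintype.split r with
          | inl m => block_mx 0 0 0 (toda_dC x m)
          | inr m => block_mx 0 (- delta_mx m m) (delta_mx m m) 0
          end.

Lemma is_derive_toda_J2 x r :
  is_derive x (delta_mx r 0) (@toda_J2 R N) (toda_dJ2 x r).
Proof.
apply/is_derive_mxP => i j; rewrite mxE -[_ * _]/(_ *: _).
apply: (@is_derive_ext _ _ _ _ (2%:R \*: (fun y => toda_J2hat y i j))).
  by move=> y; rewrite mxE.
apply: is_deriveZ.
have dq k : is_derive x (delta_mx r 0) (fun y => coord_q y k)
    ((q k == r)%:R).
  apply: is_derive_eq (is_derive_entry _ _ _ _) _.
  by rewrite mxE eqxx andbT.
have dp k : is_derive x (delta_mx r 0) (fun y => coord_p y k)
    ((p k == r)%:R).
  apply: is_derive_eq (is_derive_entry _ _ _ _) _.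
  by rewrite mxE eqxx andbT.
have dB a b : is_derive x (delta_mx r 0) (fun y => toda_B y a b)
    (- ((p a == r)%:R *+ (a == b))).
  apply: (@is_derive_ext _ _ _ _ (- (fun y => coord_p y a *+ (a == b)))).
    by move=> y; rewrite !mxE mulNrn.
  apply: is_deriveN; case: (a == b); first exact: dp.
  exact: is_derive_cst.
have dC a b : is_derive x (delta_mx r 0) (fun y => toda_C y a b)
    (toda_weight x a b * ((q a == r)%:R - (q b == r)%:R)).
  have dE c d : is_derive x (delta_mx r 0)
      (fun y : 'cV[R]_(N + N) => expR (coord_q y c - coord_q y d))
      (expR (coord_q x c - coord_q x d) * ((q c == r)%:R - (q d == r)%:R)).
    apply: (@is_derive_comp _ _ _ _ expR); exact: is_deriveB.
  rewrite /toda_weight.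
  have [e|ne] := boolP (b == a.+1 :> nat).
    by apply: is_derive_ext (dE a b) => y; rewrite mxE e.
  have [e|ne'] := boolP (a == b.+1 :> nat).
    rewrite -[_%:R - _]opprB mulrN.
    by apply: is_derive_ext (is_deriveN (dE b a)) => y; rewrite mxE (negbTE ne) e.
  rewrite mul0r; apply: is_derive_ext (is_derive_cst 0 _ _) => y.
  by rewrite mxE (negbTE ne) (negbTE ne').
have e1 a b : is_derive x (delta_mx r 0) (fun y => toda_J2hat y (q a) (q b)) 0.
  by apply: is_derive_ext (is_derive_cst (toda_A R N a b) _ _) => y;
    rewrite block_mxEul.
have e2 a b : is_derive x (delta_mx r 0) (fun y => toda_J2hat y (q a) (p b))
    (- ((p a == r)%:R *+ (a == b))).
  by apply: is_derive_ext (dB a b) => y; rewrite block_mxEur.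
have e3 a b : is_derive x (delta_mx r 0) (fun y => toda_J2hat y (p a) (q b))
    ((p a == r)%:R *+ (a == b)).
  rewrite -[_ *+ _]opprK.
  by apply: is_derive_ext (is_deriveN (dB a b)) => y; rewrite block_mxEdl mxE.
have e4 a b : is_derive x (delta_mx r 0) (fun y => toda_J2hat y (p a) (p b))
    (toda_weight x a b * ((q a == r)%:R - (q b == r)%:R)).
  by apply: is_derive_ext (dC a b) => y; rewrite block_mxEdr.
case: (split_ordP r) => m rE; case: (split_ordP i) => a ->;
  case: (split_ordP j) => b ->;
  rewrite ?block_mxEul ?block_mxEur ?block_mxEdl ?block_mxEdr.
- by apply: is_derive_eq (e1 a b) _; rewrite mxE.
- by apply: is_derive_eq (e2 a b) _; rewrite mxE rE eq_rlshift mul0rn oppr0.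
- by apply: is_derive_eq (e3 a b) _; rewrite mxE rE eq_rlshift mul0rn.
- by apply: is_derive_eq (e4 a b) _;
  rewrite mxE rE !(inj_eq (@lshift_inj _ _)) ![m == _]eq_sym.
- by apply: is_derive_eq (e1 a b) _; rewrite mxE.
- apply: is_derive_eq (e2 a b) _; rewrite !mxE rE (inj_eq (@rshift_inj _ _)).
  by have [->|] := eqVneq a m; rewrite /= ?mul0rn // eq_sym; case: eqP.
- apply: is_derive_eq (e3 a b) _; rewrite !mxE rE (inj_eq (@rshift_inj _ _)).
  by have [->|] := eqVneq a m; rewrite /= ?mul0rn // eq_sym; case: eqP.
- by apply: is_derive_eq (e4 a b) _; rewrite mxE rE !eq_lrshift subrr mulr0.
Qed.

Lemma bracketqq P x s j k : bracket P (toda_dJ2 x) s (q j) (q k) = 0.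
Proof.
rewrite /bracket big_split_ord /= !big1 ?addr0 // => m _.
  by rewrite mxE (unsplitK (inr m)) block_mxEul mxE !mulr0.
by rewrite mxE (unsplitK (inl m)) block_mxEul mxE !mulr0.
Qed.

Lemma bracketpq P x s j k :
  bracket P (toda_dJ2 x) s (p j) (q k) = 2%:R * (j == k)%:R * P s (p j).
Proof.
rewrite /bracket big_split_ord /= big1 ?add0r; last first.
  by move=> m _; rewrite mxE (unsplitK (inl m)) block_mxEdl mxE !mulr0.
rewrite (bigD1 j) //= big1 ?addr0 => [|m /negbTE nm].
  by rewrite mxE (unsplitK (inr j)) block_mxEdl mxE eqxx mulrC eq_sym.
by rewrite mxE (unsplitK (inr m)) block_mxEdl mxE eq_sym nm !mulr0.
Qed.

Lemma bracketqp P x s j k :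
  bracket P (toda_dJ2 x) s (q j) (p k) = - (2%:R * (j == k)%:R * P s (p j)).
Proof.
rewrite /bracket big_split_ord /= big1 ?add0r; last first.
  by move=> m _; rewrite mxE (unsplitK (inl m)) block_mxEur mxE !mulr0.
rewrite (bigD1 j) //= big1 ?addr0 => [|m /negbTE nm].
  rewrite mxE (unsplitK (inr j)) block_mxEur !mxE eqxx mulrC eq_sym.
  by rewrite mulrN mulNr.
by rewrite mxE (unsplitK (inr m)) block_mxEur !mxE eq_sym nm oppr0 !mulr0.
Qed.

Lemma bracketpp P x s j k :
  bracket P (toda_dJ2 x) s (p j) (p k) =
  2%:R * toda_weight x j k * (P s (q j) - P s (q k)).
Proof.
have E l : \sum_(m < N) P s (q m) * (m == l)%:R = P s (q l).
  rewrite (bigD1 l) //= eqxx mulr1 big1 ?addr0 // => m /negbTE ->.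
  by rewrite mulr0.
rewrite /bracket big_split_ord /= addrC big1 ?add0r; last first.
  by move=> m _; rewrite mxE (unsplitK (inr m)) block_mxEdr mxE !mulr0.
rewrite -!E -sumrB mulr_sumr; apply: eq_bigr => m _.
rewrite mxE (unsplitK (inl m)) block_mxEdr mxE.
by rewrite -mulrBr mulrCA -!mulrA; congr (_ * _); rewrite mulrCA.
Qed.

Lemma cyclic_sumC P (dJ : 'I_(N + N) -> 'M[R]_(N + N)) s l t :
  cyclic_sum P dJ s l t = cyclic_sum P dJ l t s.
Proof. by rewrite /cyclic_sum [RHS]addrC addrA. Qed.

(** The mixed blocks of J1 and J2 are diagonal, so one verification serves
    both.  By cyclic symmetry only the numbers of q's and p's among the three
    coordinates matter.  With at most one p, the identity follows from the
    diagonal shape; with three, from the symmetry of the weight.  The case of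
    one q and two p's is the last hypothesis. *)
Lemma toda_cyclic P x (c : 'I_N -> R) :
  (forall i j, P (q i) (p j) = - ((i == j)%:R * c i)) ->
  (forall i j, P (p i) (q j) = (i == j)%:R * c i) ->
  (forall i j, P (p i) (p j) = - P (p j) (p i)) ->
  (forall i j k, toda_weight x j k * (P (q i) (q j) - P (q i) (q k)) +
                ((i == j)%:R + (i == k)%:R) * P (p j) (p k) = 0) ->
  forall s l t, cyclic_sum P (toda_dJ2 x) s l t = 0.
Proof.
move=> Pqp Ppq Ppp Hw.
have hqqq i j k : cyclic_sum P (toda_dJ2 x) (q i) (q j) (q k) = 0.
  by rewrite /cyclic_sum !bracketqq !addr0.
have hqqp i j k : cyclic_sum P (toda_dJ2 x) (q i) (q j) (p k) = 0.
  rewrite /cyclic_sum bracketqq bracketqp bracketpq !Pqp.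
  have [->|njk] := eqVneq j k; last first.
    by rewrite !(mul0r, mulr0, oppr0, addr0).
  rewrite [k == i]eq_sym; have [->|nik] := eqVneq i k; last first.
    by rewrite !(mul0r, mulr0, oppr0, addr0).
  by rewrite addr0 addNr.
have hqpp i j k : cyclic_sum P (toda_dJ2 x) (q i) (p j) (p k) = 0.
  have eij : (i == j)%:R * P (p k) (p i) = - ((i == j)%:R * P (p j) (p k)).
    by case: (eqVneq i j) => [->|_]; rewrite ?mul0r ?oppr0 // mul1r mul1r -Ppp.
  rewrite /cyclic_sum bracketqp bracketpp bracketpq [k == i]eq_sym.
  rewrite -!mulrA eij mulrN opprK -!mulrDr -addrA.
  by rewrite [_ * P _ _ + _]addrC -mulrDl Hw mulr0.
have hppp i j k : cyclic_sum P (toda_dJ2 x) (p i) (p j) (p k) = 0.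
  (* The six terms cancel in pairs, one pair for each pair of indices. *)
  have D a b d : (a == b)%:R * (toda_weight x b d * c a) -
      (a == b)%:R * (toda_weight x d a * c b) = 0.
    by case: (eqVneq a b) => [->|_]; rewrite ?mul0r ?subrr // toda_weightC subrr.
  rewrite /cyclic_sum !bracketpp !Ppq [i == k]eq_sym [j == i]eq_sym [k == j]eq_sym.
  transitivity (2%:R * (0 + 0 + 0 : R)); last by rewrite !addr0 mulr0.
  by rewrite -{1}(D i j k) -{1}(D j k i) -{1}(D k i j); ring.
move=> s l t.
case: (split_ordP s) => i ->; case: (split_ordP l) => j ->;
  case: (split_ordP t) => k -> //.
all: by [rewrite cyclic_sumC | rewrite -cyclic_sumC | rewrite 2!cyclic_sumC].
Qed.

Lemma toda_J1_unit x : toda_J1 x \in unitmx.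
Proof.
apply: (proj1 (@mulmx1_unit _ _ _ ((4%:R)^-1 *: block_mx 0 (- 1%:M) 1%:M 0) _)).
rewrite -scalemxAl -scalemxAr scalerA divff ?pnatr_eq0 // scale1r.
rewrite mulmx_block !mulmx0 !mul0mx !mulmx1 mulNmx mulmxN mul1mx opprK.
by rewrite !addr0 !add0r -scalar_mx_block.
Qed.

Lemma toda_J1_skew x : (toda_J1 x)^T = - toda_J1 x.
Proof.
rewrite /toda_J1 linearZ /= -scalerN; congr (_ *: _).
rewrite /toda_J1hat tr_block_mx opp_block_mx !trmx0 linearN /= trmx1.
by rewrite opprK oppr0.
Qed.

Lemma toda_C_skew x : (toda_C x)^T = - toda_C x.
Proof.
apply/matrixP => a b; rewrite !mxE.
by do ![case: eqP]; rewrite ?opprK ?oppr0 // => *; lia.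
Qed.

Lemma toda_J2_skew x : (toda_J2 x)^T = - toda_J2 x.
Proof.
rewrite /toda_J2 linearZ /= -scalerN; congr (_ *: _).
rewrite /toda_J2hat tr_block_mx opp_block_mx toda_C_skew linearN /=.
rewrite !tr_diag_mx opprK.
congr block_mx; apply/matrixP => a b; rewrite !mxE.
by case: ltngtP; rewrite ?opprK ?oppr0.
Qed.

Lemma toda_dJ2_skew x r : (toda_dJ2 x r)^T = - toda_dJ2 x r.
Proof.
rewrite /toda_dJ2 linearZ /= -scalerN; congr (_ *: _).
case: (fintype.split r) => m; rewrite tr_block_mx opp_block_mx !trmx0 !oppr0.
  congr block_mx; apply/matrixP => a b; rewrite !mxE toda_weightC -mulrN.
  by rewrite opprB.
by rewrite linearN /= trmx_delta opprK.
Qed.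

Lemma toda_J1_cyclic x s l t : cyclic_sum (toda_J1 x) (toda_dJ2 x) s l t = 0.
Proof.
apply: (toda_cyclic (c := fun=> - 4%:R)) => [i j|i j|i j|i j k];
  rewrite /toda_J1 scale_block_mx
    ?block_mxEul ?block_mxEur ?block_mxEdl ?block_mxEdr !mxE.
- by rewrite mulrN opprK mulrC.
- by rewrite mulrN mulrN mulrC.
- by rewrite mulr0 oppr0.
- by rewrite !mulr0 subr0 mulr0 addr0.
Qed.

Lemma toda_J2_cyclic x s l t : cyclic_sum (toda_J2 x) (toda_dJ2 x) s l t = 0.
Proof.
apply: (toda_cyclic (c := fun i => 2%:R * coord_p x i)) => [i j|i j|i j|i j k];
  rewrite /toda_J2 scale_block_mx
    ?block_mxEul ?block_mxEur ?block_mxEdl ?block_mxEdr.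
- by rewrite !mxE; case: eqVneq => /= _; ring.
- by rewrite !mxE; case: eqVneq => /= _; ring.
- by have /matrixP/(_ j i) := toda_C_skew x; rewrite !mxE => ->; rewrite mulrN.
(* For j and k adjacent, A_ij and A_ik agree unless i is one of j and k, where
   the jump of A is compensated by the other term. *)
rewrite !mxE /toda_weight -![_ == _ :> 'I_N]val_eqE /=.
case: (eqVneq (k : nat) j.+1) => [->|nk].
  case: ltngtP => ij; case: ltngtP => ik; try lia; rewrite /=; ring.
case: (eqVneq (j : nat) k.+1) => [->|nj].
  case: ltngtP => ij; case: ltngtP => ik; try lia; rewrite /=; ring.
by rewrite !(mul0r, mulr0) addr0.
Qed.

Lemma is_derive_recursion x r :
  is_derive x (delta_mx r 0) (@recursion_operator R N)
    (toda_dJ2 x r *m invmx (toda_J1 x)).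
Proof.
exact: is_derive_mulmxr (invmx (toda_J1 x)) (is_derive_toda_J2 x r).
Qed.

Lemma toda_Y_contracted j x :
  toda_Y j x = \col_k \sum_r
    (deriv_expmx (recursion_operator x)
       (toda_dJ2 x r *m invmx (toda_J1 x)) (j - 1) *m toda_J1 x) k r.
Proof.
apply/matrixP => k o; rewrite !mxE; apply: eq_bigr => r _.
have /is_derive_mxP/(_ k r)[_ dE] := is_derive_mulmxr (toda_J1 x)
  (is_derive_expmx (j - 1) (is_derive_recursion x r)).
exact: dE.
Qed.

(** By Jacobi's formula the gradient of ln (sqrt (det R)) is half the trace of
    dR R^-1 = dJ K R^-1, and K R^-1 = J2^-1. *)
Lemma grad_toda_f x : 0 < \det (recursion_operator x) ->
  grad (@toda_f R N) x =
    (2%:R)^-1 *: trace_form (toda_dJ2 x) (invmx (toda_J2 x)).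
Proof.
move=> hx; apply/matrixP => r o; rewrite {o}(ord1 o) !mxE.
have hs : 0 < Num.sqrt (\det (recursion_operator x)) by rewrite sqrtr_gt0.
have D1 := is_derive_det (is_derive_recursion x r).
have D2 := is_derive_comp (f := Num.sqrt)
  (g := fun y => \det (@recursion_operator R N y)) (is_derive1_sqrt hx) D1.
have D := is_derive_comp (f := @ln R)
  (g := Num.sqrt \o (fun y => \det (@recursion_operator R N y)))
  (is_derive1_ln hs) D2.
transitivity ('D_(delta_mx r 0) (@ln R \o
    (Num.sqrt \o (fun y => \det (@recursion_operator R N y)))) x); first by [].
rewrite (@derive_val _ _ _ _ _ _ _ D).
have uR : recursion_operator x \in unitmx by rewrite unitmxE unitfE gt_eqF.
have uJ2 : toda_J2 x \in unitmx by move: uR; rewrite unitmx_mul => /andP[].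
have iR : invmx (recursion_operator x) = toda_J1 x *m invmx (toda_J2 x).
  apply: (can_inj (mulKmx uR)); rewrite mulmxV // mulmxA mulmxKV ?toda_J1_unit //.
  by rewrite mulmxV.
have -> : \adj (recursion_operator x) =
    \det (recursion_operator x) *: (toda_J1 x *m invmx (toda_J2 x)).
  by rewrite -iR /invmx uR scalerA divff ?scale1r // gt_eqF.
rewrite -scalemxAr mxtraceZ !mulmxA mulmxKV ?toda_J1_unit //.
set d := \det _ in hx hs *.
rewrite -[in LHS](sqr_sqrtr (ltW hx)) sqrtr_sqr ger0_norm ?ltW //.
have s0 : Num.sqrt d != 0 by rewrite gt_eqF.
by field.
Qed.

End TodaTensors.

Theorem theorem5 (R : realType) (N : nat) (hN : (2 <= N)%N)
    (j : nat) (hj : (1 <= j)%N) (x : 'cV[R]_(N + N))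
    (hx : 0 < \det (recursion_operator x)) :
  toda_Y j x =
    (j - 1)%N%:R *: hamiltonian_field (toda_J j) (@toda_f R N) x.
Proof.
have uR : recursion_operator x \in unitmx by rewrite unitmxE unitfE gt_eqF.
have uJ2 : toda_J2 x \in unitmx by move: uR; rewrite unitmx_mul => /andP[].
rewrite toda_Y_contracted /hamiltonian_field grad_toda_f //.
apply: (divergence_hierarchy (J2 := toda_J2 x)) => //.
- exact: toda_J1_skew.
- exact: toda_J2_skew.
- exact: toda_dJ2_skew.
- exact: toda_J1_unit.
- exact: toda_J1_cyclic.
- exact: toda_J2_cyclic.
Qed.
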